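(* The Giry monad $\mathcal{G}$ on $\mathbf{Meas}$ is the codensity monad of the functor $U_{\mathcal{D}}\colon\mathbf{Kl}_{\mathsf c}(\mathcal{D})\to\mathbf{Meas}$.
   Context: $\mathbf{Meas}$ is the category of measurable spaces and measurable maps. The Giry monad sends $(X,\Sigma_X)$ to the set $\mathcal{G}X$ of (countably additive) probability measures on $X$, equipped with the $\sigma$-algebra induced as a subspace of the power $[0,1]^{\Sigma_X}$ in $\mathbf{Meas}$ ($[0,1]$ with its Borel $\sigma$-algebra), with the usual Dirac unit and integration multiplication. $\mathcal{D}$ is the countable (discrete) distribution monad on $\mathbf{Set}$: $\mathcal{D}X$ is the set of maps $p\colon X\to[0,1]$ with $\sum_x p(x)=1$. $\mathbf{Kl}_{\mathsf c}(\mathcal{D})$ is the full subcategory of the Kleisli category of $\mathcal{D}$ on countable sets, and $U_{\mathcal{D}}$ sends a countable set $X$ to $\mathcal{D}X$ with the $\sigma$-algebra induced as a subspace of $[0,1]^X$, and a Kleisli morphism $f\colon X\to\mathcal{D}Y$ to $f^\#=\mu\circ\mathcal{D}f$. The codensity monad of a functor $F$ is $\mathrm{Ran}_FF$ with its canonical monad structure induced by the universal property; ''is the codensity monad'' means isomorphic as monads. *)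

(* Defs.v *)
From HB Require Import structures.
From mathcomp Require Import all_boot all_order all_algebra.
From mathcomp Require Import all_classical all_reals all_analysis.
From mathcomp Require Import measurable_realfun.
From mathcomp Require Import lra.
From mathcomp Require Import giry.

Set Implicit Arguments.
Unset Strict Implicit.
Unset Printing Implicit Defensive.
Import Order.TTheory GRing.Theory Num.Theory.
Import numFieldNormedType.Exports.

Local Open Scope classical_set_scope.
Local Open Scope ring_scope.

Declare Scope cat_scope.
Delimit Scope cat_scope with cat.
Local Open Scope cat_scope.

Record category := Category {
  obj :> Type;
  hom : obj -> obj -> Type;
  idm : forall X, hom X X;
  comp : forall X Y Z, hom Y Z -> hom X Y -> hom X Z;
  comp1m : forall X Y (f : hom X Y), comp (idm Y) f = f;
  compm1 : forall X Y (f : hom X Y), comp f (idm X) = f;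
  compA : forall X Y Z W (h : hom Z W) (g : hom Y Z) (f : hom X Y),
    comp h (comp g f) = comp (comp h g) f }.

Arguments idm {c} X.
Arguments comp {c X Y Z}.
Notation "g ∘ f" := (comp g f) (at level 40, left associativity) : cat_scope.

Record functor (C D : category) := Functor {
  fobj :> C -> D;
  fmap : forall X Y : C, hom X Y -> hom (fobj X) (fobj Y);
  fmap1 : forall X : C, fmap (idm X) = idm (fobj X);
  fmapM : forall (X Y Z : C) (g : hom Y Z) (f : hom X Y),
    fmap (g ∘ f) = fmap g ∘ fmap f }.

Record nat_trans (C D : category) (F G : functor C D) := NatTrans {
  napp :> forall X : C, hom (F X) (G X);
  naturality : forall (X Y : C) (f : hom X Y),
    fmap G f ∘ napp X = napp Y ∘ fmap F f }.

Section functor_id_comp.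
Variables C D E : category.

Definition functor_id : functor C C :=
  @Functor C C id (fun _ _ f => f) (fun=> erefl) (fun _ _ _ _ _ => erefl).

Variables (G : functor D E) (F : functor C D).

Lemma functor_comp1 X : fmap G (fmap F (idm X)) = idm (G (F X)).
Proof. by rewrite !fmap1. Qed.

Lemma functor_compM X Y Z (g : hom Y Z) (f : hom X Y) :
  fmap G (fmap F (g ∘ f)) = fmap G (fmap F g) ∘ fmap G (fmap F f).
Proof. by rewrite !fmapM. Qed.

(* [functor_comp G F] is G after F. *)
Definition functor_comp : functor C E :=
  @Functor C E (fun X => G (F X)) (fun X Y f => fmap G (fmap F f))
    functor_comp1 functor_compM.

End functor_id_comp.
Arguments functor_id C : clear implicits.

Record monad (C : category) := Monad {
  mfunctor :> functor C C;
  munit : nat_trans (functor_id C) mfunctor;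
  mmult : nat_trans (functor_comp mfunctor mfunctor) mfunctor;
  mmultA : forall X,
    mmult X ∘ fmap mfunctor (mmult X) = mmult X ∘ mmult (mfunctor X);
  mmult_fmap_unit : forall X,
    mmult X ∘ fmap mfunctor (munit X) = idm (mfunctor X);
  mmult_unit : forall X, mmult X ∘ munit (mfunctor X) = idm (mfunctor X) }.

Definition monad_morphism (C : category) (S T : monad C)
    (phi : nat_trans S T) : Prop :=
  (forall X, phi X ∘ munit S X = munit T X) /\
  (forall X, phi X ∘ mmult S X = mmult T X ∘ (phi (T X) ∘ fmap S (phi X))).

Definition monad_isomorphic (C : category) (S T : monad C) : Prop :=
  exists (phi : nat_trans S T) (psi : nat_trans T S),
    [/\ monad_morphism phi, monad_morphism psi,
        forall X, psi X ∘ phi X = idm (S X) &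
        forall X, phi X ∘ psi X = idm (T X)].

Section kleisli.
Variables (C : category) (T : monad C).

Definition kleisli_hom (X Y : C) := hom X (T Y).

Definition kleisli_comp X Y Z (g : kleisli_hom Y Z) (f : kleisli_hom X Y) :
  kleisli_hom X Z := mmult T Z ∘ fmap T g ∘ f.

Lemma kleisli_comp1m X Y (f : kleisli_hom X Y) :
  kleisli_comp (munit T Y) f = f.
Proof. by rewrite /kleisli_comp mmult_fmap_unit comp1m. Qed.

Lemma kleisli_compm1 X Y (f : kleisli_hom X Y) :
  kleisli_comp f (munit T X) = f.
Proof.
by rewrite /kleisli_comp -compA (naturality (munit T)) compA mmult_unit comp1m.
Qed.

Lemma kleisli_compA X Y Z W (h : kleisli_hom Z W) (g : kleisli_hom Y Z)
    (f : kleisli_hom X Y) :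
  kleisli_comp h (kleisli_comp g f) = kleisli_comp (kleisli_comp h g) f.
Proof.
rewrite /kleisli_comp !compA !fmapM !compA mmultA; congr (_ ∘ _ ∘ _).
by rewrite -!compA; congr (_ ∘ _); exact: (naturality (mmult T)).
Qed.

Definition kleisli : category :=
  @Category C kleisli_hom (fun X => munit T X) kleisli_comp
    kleisli_comp1m kleisli_compm1 kleisli_compA.

End kleisli.

Definition full_subcategory (C : category) (P : C -> Prop) : category :=
  @Category {X : C | P X} (fun X Y => hom (sval X) (sval Y))
    (fun X => idm (sval X)) (fun X Y Z g f => g ∘ f)
    (fun X Y f => comp1m f) (fun X Y f => compm1 f)
    (fun X Y Z W h g f => compA h g f).

Section right_kan_extension.
Variables (C D E : category) (K : functor C D) (F : functor C E).

(* A right Kan extension of [F] along [K]: a functor [ran] with a counit through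
   which every [H \o K => F] factors uniquely. *)
Record right_kan := RightKan {
  ran : functor D E;
  ran_counit : nat_trans (functor_comp ran K) F;
  ran_lift : forall H : functor D E,
    nat_trans (functor_comp H K) F -> nat_trans H ran;
  ran_liftK : forall (H : functor D E) (s : nat_trans (functor_comp H K) F) X,
    ran_counit X ∘ ran_lift s (K X) = s X;
  ran_lift_uniq : forall (H : functor D E)
    (s : nat_trans (functor_comp H K) F) (t : nat_trans H ran),
    (forall X, ran_counit X ∘ t (K X) = s X) -> forall Y, t Y = ran_lift s Y }.

End right_kan_extension.

Section codensity_monad.
Variables (C D : category) (F : functor C D) (r : right_kan F F).
Let T := ran r.
Let e := ran_counit r.

Lemma codensity_ext (H : functor D D) (t t' : nat_trans H T) :
  (forall X, e X ∘ t (F X) = e X ∘ t' (F X)) -> forall Y, t Y = t' Y.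
Proof.
move=> tt' Y.
have nat_s (X X' : C) (f : hom X X') :
    fmap F f ∘ (e X ∘ t (F X)) = (e X' ∘ t (F X')) ∘ fmap (functor_comp H F) f.
  rewrite compA (naturality e) -!compA; congr (_ ∘ _).
  exact: (naturality t).
have := @ran_lift_uniq _ _ _ _ _ r H
  (@NatTrans _ _ (functor_comp H F) F (fun X => e X ∘ t (F X)) nat_s).
by move=> u; rewrite (u t)// (u t')// => X; rewrite -tt'.
Qed.

Lemma codensity_unit_subproof (X Y : C) (f : hom X Y) :
  fmap F f ∘ idm (F X) = idm (F Y) ∘ fmap (functor_comp (functor_id D) F) f.
Proof. by rewrite compm1 comp1m. Qed.

(* The transpose of the identity of [F]. *)
Definition codensity_unit : nat_trans (functor_id D) T :=
  ran_lift r (@NatTrans _ _ (functor_comp (functor_id D) F) F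
    (fun X => idm (F X)) codensity_unit_subproof).

Lemma codensity_mult_subproof (X Y : C) (f : hom X Y) :
  fmap F f ∘ (e X ∘ fmap T (e X)) =
  (e Y ∘ fmap T (e Y)) ∘ fmap (functor_comp (functor_comp T T) F) f.
Proof.
rewrite compA (naturality e) -!compA /=; congr (_ ∘ _).
by rewrite -!fmapM (naturality e).
Qed.

(* The transpose of the composite T T F => T F => F of counits. *)
Definition codensity_mult : nat_trans (functor_comp T T) T :=
  ran_lift r (@NatTrans _ _ (functor_comp (functor_comp T T) F) F
    (fun X => e X ∘ fmap T (e X)) codensity_mult_subproof).

Let unitE X : e X ∘ codensity_unit (F X) = idm (F X).
Proof. by rewrite /codensity_unit ran_liftK. Qed.

Let multE X : e X ∘ codensity_mult (F X) = e X ∘ fmap T (e X).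
Proof. by rewrite /codensity_mult ran_liftK. Qed.

Let multN (X Y : D) (f : hom X Y) :
  fmap T f ∘ codensity_mult X = codensity_mult Y ∘ fmap T (fmap T f).
Proof. exact: (naturality codensity_mult). Qed.

Let unitN (X Y : D) (f : hom X Y) :
  fmap T f ∘ codensity_unit X = codensity_unit Y ∘ f.
Proof. exact: (naturality codensity_unit). Qed.

Lemma codensity_multA X :
  codensity_mult X ∘ fmap T (codensity_mult X) =
  codensity_mult X ∘ codensity_mult (T X).
Proof.
pose TTT := functor_comp T (functor_comp T T).
have n1 (Y Z : D) (f : hom Y Z) :
    fmap T f ∘ (codensity_mult Y ∘ fmap T (codensity_mult Y)) =
    (codensity_mult Z ∘ fmap T (codensity_mult Z)) ∘ fmap T (fmap T (fmap T f)).
  rewrite compA multN -!compA; congr (_ ∘ _).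
  by rewrite -!fmapM multN.
have n2 (Y Z : D) (f : hom Y Z) :
    fmap T f ∘ (codensity_mult Y ∘ codensity_mult (T Y)) =
    (codensity_mult Z ∘ codensity_mult (T Z)) ∘ fmap T (fmap T (fmap T f)).
  by rewrite compA multN -!compA multN.
apply: (codensity_ext (t := @NatTrans _ _ TTT T (fun Y => codensity_mult Y ∘ fmap T (codensity_mult Y)) n1)
  (t' := @NatTrans _ _ TTT T (fun Y => codensity_mult Y ∘ codensity_mult (T Y)) n2)) => Y /=.
rewrite !compA !multE -!compA multN !compA multE -!compA -!fmapM.
by rewrite multE.
Qed.

Lemma codensity_mult_fmap_unit X :
  codensity_mult X ∘ fmap T (codensity_unit X) = idm (T X).
Proof.
have n1 (Y Z : D) (f : hom Y Z) :
    fmap T f ∘ (codensity_mult Y ∘ fmap T (codensity_unit Y)) =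
    (codensity_mult Z ∘ fmap T (codensity_unit Z)) ∘ fmap T f.
  rewrite compA multN -!compA; congr (_ ∘ _).
  by rewrite -!fmapM unitN.
have n2 (Y Z : D) (f : hom Y Z) :
    fmap T f ∘ idm (T Y) = idm (T Z) ∘ fmap T f by rewrite compm1 comp1m.
apply: (codensity_ext (t := @NatTrans _ _ T T (fun Y => codensity_mult Y ∘ fmap T (codensity_unit Y)) n1)
  (t' := @NatTrans _ _ T T (fun Y => idm (T Y)) n2)) => Y /=.
by rewrite compA multE -compA -fmapM unitE fmap1.
Qed.

Lemma codensity_mult_unit X :
  codensity_mult X ∘ codensity_unit (T X) = idm (T X).
Proof.
have n1 (Y Z : D) (f : hom Y Z) :
    fmap T f ∘ (codensity_mult Y ∘ codensity_unit (T Y)) =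
    (codensity_mult Z ∘ codensity_unit (T Z)) ∘ fmap T f.
  by rewrite compA multN -!compA unitN.
have n2 (Y Z : D) (f : hom Y Z) :
    fmap T f ∘ idm (T Y) = idm (T Z) ∘ fmap T f by rewrite compm1 comp1m.
apply: (codensity_ext (t := @NatTrans _ _ T T (fun Y => codensity_mult Y ∘ codensity_unit (T Y)) n1)
  (t' := @NatTrans _ _ T T (fun Y => idm (T Y)) n2)) => Y /=.
by rewrite compA multE -compA unitN compA unitE comp1m compm1.
Qed.

Definition codensity_monad : monad D :=
  Monad codensity_multA codensity_mult_fmap_unit codensity_mult_unit.

End codensity_monad.

Definition is_codensity_monad (C D : category) (F : functor C D)
    (T : monad D) : Prop :=
  exists r : right_kan F F, monad_isomorphic T (codensity_monad r).

(* The measurable types of MathComp-Analysis are pointed; the empty space is an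
   object of Meas (and the value of both monads at the empty set), hence the
   unpointed structure below. *)
Record meas_space := MeasSpace {
  mcarrier :> Type;
  msets : set (set mcarrier);
  msets_sigma_algebra : sigma_algebra [set: mcarrier] msets }.
Arguments msets : clear implicits.

Record meas_map (X Y : meas_space) := MeasMap {
  mmap :> X -> Y;
  mmapP : forall B, msets Y B -> msets X (mmap @^-1` B) }.

Lemma meas_map_ext (X Y : meas_space) (f g : meas_map X Y) : f =1 g -> f = g.
Proof.
case: f g => [f mf] [g mg] /= /funext fg; rewrite {}fg in mf *.
by congr MeasMap; exact: Prop_irrelevance.
Qed.

Definition meas_id (X : meas_space) : meas_map X X :=
  @MeasMap X X id (fun _ mB => mB).

Definition meas_comp (X Y Z : meas_space) (g : meas_map Y Z)
    (f : meas_map X Y) : meas_map X Z :=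
  @MeasMap X Z (g \o f) (fun _ mB => mmapP f (mmapP g mB)).

Lemma meas_comp1m X Y (f : meas_map X Y) : meas_comp (meas_id Y) f = f.
Proof. exact: meas_map_ext. Qed.

Lemma meas_compm1 X Y (f : meas_map X Y) : meas_comp f (meas_id X) = f.
Proof. exact: meas_map_ext. Qed.

Lemma meas_compA X Y Z W (h : meas_map Z W) (g : meas_map Y Z)
    (f : meas_map X Y) : meas_comp h (meas_comp g f) = meas_comp (meas_comp h g) f.
Proof. exact: meas_map_ext. Qed.

Definition Meas : category := @Category meas_space meas_map meas_id meas_comp
  meas_comp1m meas_compm1 meas_compA.

Definition sets : category := @Category Type (fun X Y => X -> Y) (fun X => id)
  (fun X Y Z g f => g \o f) (fun _ _ _ => erefl) (fun _ _ _ => erefl)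
  (fun _ _ _ _ _ _ _ => erefl).

Definition subspace (X : meas_space) (A : set X) : meas_space :=
  @MeasSpace A (preimage_set_system setT val (msets X))
    (sigma_algebra_preimage setT val (msets_sigma_algebra X)).

Definition power (I : Type) (X : meas_space) : meas_space :=
  @MeasSpace (I -> X)
    <<s \bigcup_i preimage_set_system setT (fun p : I -> X => p i) (msets X) >>
    (smallest_sigma_algebra _ _).

Section unit_interval.
Variable R : realType.

Definition borel : meas_space :=
  @MeasSpace R measurable (sigma_algebra_measurable R).

Definition unit_interval : meas_space :=
  @subspace borel [set x : R | 0 <= x <= 1].

Definition ereal_of (t : unit_interval) : \bar R := (val t)%:E.

Lemma ereal_of_ge0 t : (0 <= ereal_of t)%E.
Proof. by have /set_mem/= /andP[t0 _] := valP t; rewrite lee_fin. Qed.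

Lemma ereal_of_le1 t : (ereal_of t <= 1)%E.
Proof. by have /set_mem/= /andP[_ t1] := valP t; rewrite lee_fin. Qed.

Lemma ereal_of_inj : injective ereal_of.
Proof. by move=> s t [] /val_inj. Qed.

Lemma fin_num01 (x : \bar R) : (0 <= x <= 1)%E -> x \is a fin_num.
Proof.
by move=> /andP[x0 x1]; rewrite ge0_fin_numE// (le_lt_trans x1)// ltry.
Qed.

Lemma of_ereal_subproof (x : \bar R) : (0 <= x <= 1)%E ->
  fine x \in [set x : R | 0 <= x <= 1].
Proof.
by move=> x01; rewrite inE /= -!lee_fin fineK// fin_num01.
Qed.

Definition of_ereal (x : \bar R) (x01 : (0 <= x <= 1)%E) : unit_interval :=
  exist _ (fine x) (of_ereal_subproof x01).

Lemma of_erealK (x : \bar R) (x01 : (0 <= x <= 1)%E) :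
  ereal_of (of_ereal x01) = x.
Proof. by rewrite /ereal_of /= fineK// fin_num01. Qed.

End unit_interval.
Arguments ereal_of {R} t.

Section distribution_monad.
Variable R : realType.
Local Notation I := (unit_interval R).
Local Open Scope ereal_scope.

(* [{classic X}] is [X] with the choice structure required by [esum]. *)
Definition is_distribution (X : Type) : set (X -> I) :=
  [set p | \esum_(x in @setT {classic X}) ereal_of (p x) = 1].

Definition dist (X : Type) : Type := @is_distribution X.

Definition dapp (X : Type) (p : dist X) (x : X) : I := val p x.
Coercion dapp : dist >-> Funclass.

Lemma dist_ext X (p q : dist X) :
  (forall x, ereal_of (p x) = ereal_of (q x)) -> p = q.
Proof. by move=> pq; apply/val_inj/funext => x; exact/ereal_of_inj/pq. Qed.

Lemma dist_sum1 X (p : dist X) : \esum_(x in @setT {classic X}) ereal_of (p x) = 1.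
Proof. by have /set_mem := valP p. Qed.

Lemma esumZl (T : choiceType) (A : set T) (c : \bar R) (h : T -> \bar R) :
  0 <= c -> c \is a fin_num -> (forall x, 0 <= h x) ->
  \esum_(x in A) (c * h x) = c * \esum_(x in A) h x.
Proof.
case: c => [c| |]// c0 _ h0; rewrite /esum -ereal_supZl//; last first.
  by apply/set0P; exists (\sum_(x \in set0) h x), set0 => //; exact: fsets_set0.
congr ereal_sup; rewrite image_comp; apply: eq_imagel => B _ /=.
by rewrite ge0_mule_fsumr.
Qed.

Lemma exchange_esum (T1 T2 : choiceType) (h : T1 -> T2 -> \bar R) :
  (forall x y, 0 <= h x y) ->
  \esum_(x in setT) \esum_(y in setT) h x y =
  \esum_(y in setT) \esum_(x in setT) h x y.
Proof.
move=> h0; rewrite !esum_esum//.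
have e (U V : Type) : [set: U] `*`` (fun=> [set: V]) = [set: U * V].
  by apply/seteqP; split.
rewrite !e (reindex_esum setT setT (fun x : T2 * T1 => (x.2, x.1))) //.
split => //=; first by move=> [a b] [c d] _ _ [-> ->].
by move=> [a b] _; exists (b, a).
Qed.

Lemma mean01 X (p : dist X) (h : X -> I) :
  0 <= \esum_(x in @setT {classic X}) (ereal_of (p x) * ereal_of (h x)) <= 1.
Proof.
rewrite esum_ge0/= => [|x _]; last by rewrite mule_ge0 ?ereal_of_ge0.
rewrite -[leRHS](dist_sum1 p); apply: le_esum => x _.
by rewrite -[leRHS]mule1 lee_wpmul2l ?ereal_of_ge0 ?ereal_of_le1.
Qed.

Definition mean X (p : dist X) (h : X -> I) : I := of_ereal (mean01 p h).

Lemma meanE X (p : dist X) (h : X -> I) : ereal_of (mean p h) =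
  \esum_(x in @setT {classic X}) (ereal_of (p x) * ereal_of (h x)).
Proof. exact: of_erealK. Qed.

Lemma indic01 X (A : set X) (x : X) : 0 <= (\1_A x : R)%:E <= 1.
Proof. by rewrite indicE; case: (_ \in _); rewrite !lee_fin ?lexx ?ler01. Qed.

Definition indicI X (A : set X) (x : X) : I := of_ereal (indic01 A x).

Lemma indicIE X (A : set X) (x : X) : ereal_of (indicI A x) = (\1_A x)%:E.
Proof. exact: of_erealK. Qed.

Lemma indicI1C X (a x : X) : indicI [set a] x = indicI [set x] a.
Proof.
apply: ereal_of_inj; rewrite !indicIE !indicE; congr (_%:R%:E); congr nat_of_bool.
by apply/idP/idP; rewrite !inE => ->.
Qed.

Lemma is_distribution_indicIT X (p : X -> I) : is_distribution p <->
  \esum_(x in @setT {classic X}) (ereal_of (p x) * ereal_of (indicI setT x)) = 1.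
Proof.
rewrite /is_distribution /mkset; set s := esum _ _; set t := esum _ _.
suff -> : t = s by [].
by apply: eq_esum => x _; rewrite indicIE indicE in_setT mule1.
Qed.

Lemma mean_indicIT X (p : dist X) : ereal_of (mean p (indicI setT)) = 1.
Proof. by rewrite meanE; apply/is_distribution_indicIT; exact: dist_sum1. Qed.

Lemma dmap01 X Y (f : X -> Y) (p : dist X) (y : Y) :
  0 <= \esum_(x in f @^-1` [set y] : set {classic X}) ereal_of (p x) <= 1.
Proof.
rewrite esum_ge0/= => [|x _]; last exact: ereal_of_ge0.
rewrite esum_mkcond -[leRHS](dist_sum1 p); apply: le_esum => x _.
by case: ifP => // _; exact: ereal_of_ge0.
Qed.

Definition dmap_fun X Y (f : X -> Y) (p : dist X) (y : Y) : I :=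
  of_ereal (dmap01 f p y).

Lemma mean_dmap_fun X Y (f : X -> Y) (p : dist X) (h : Y -> I) :
  \esum_(y in @setT {classic Y}) (ereal_of (dmap_fun f p y) * ereal_of (h y)) =
  ereal_of (mean p (h \o f)).
Proof.
rewrite meanE; transitivity
  (\esum_(y in @setT {classic Y}) \esum_(x in @setT {classic X})
    (if x \in f @^-1` [set y] then ereal_of (p x) * ereal_of (h y) else 0)).
  apply: eq_esum => y _; rewrite of_erealK muleC esum_mkcond.
  rewrite -esumZl ?ereal_of_ge0//; last first.
    by move=> x; case: ifP => // _; exact: ereal_of_ge0.
  by apply: eq_esum => x _; rewrite muleC; case: ifP => // _; rewrite mul0e.
rewrite exchange_esum; last first.
  by move=> y x; case: ifP => // _; rewrite mule_ge0// ereal_of_ge0.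
apply: eq_esum => x _.
rewrite (esumID [set f x : {classic Y}])//; last first.
  by move=> y _; case: ifP => // _; rewrite mule_ge0// ereal_of_ge0.
rewrite setTI esum_set1; last first.
  by case: ifP => // _; rewrite mule_ge0// ereal_of_ge0.
rewrite mem_set//= esum1 ?adde0// => y [_ yfx].
by rewrite memNset//= => /esym.
Qed.

Lemma dmap_is_distribution X Y (f : X -> Y) (p : dist X) :
  is_distribution (dmap_fun f p).
Proof.
by apply/is_distribution_indicIT; rewrite mean_dmap_fun; exact: mean_indicIT.
Qed.

Definition dmap X Y (f : X -> Y) (p : dist X) : dist Y :=
  exist _ (dmap_fun f p) (mem_set (dmap_is_distribution f p)).

Lemma mean_dmap X Y (f : X -> Y) (p : dist X) (h : Y -> I) :
  mean (dmap f p) h = mean p (h \o f).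
Proof. by apply: ereal_of_inj; rewrite meanE mean_dmap_fun. Qed.

Definition dunit_fun X (a : X) : X -> I := indicI [set a].

Lemma mean_dunit_fun X (a : X) (h : X -> I) :
  \esum_(x in @setT {classic X}) (ereal_of (dunit_fun a x) * ereal_of (h x)) =
  ereal_of (h a).
Proof.
rewrite (esumID [set a : {classic X}])//; last first.
  by move=> x _; rewrite mule_ge0// ereal_of_ge0.
rewrite setTI esum_set1; last by rewrite mule_ge0// ereal_of_ge0.
rewrite indicIE indicE mem_set// mul1e esum1 ?adde0// => x [_ xa].
by rewrite indicIE indicE memNset// mul0e.
Qed.

Lemma dunit_is_distribution X (a : X) : is_distribution (dunit_fun a).
Proof.
apply/is_distribution_indicIT; rewrite mean_dunit_fun.
by rewrite indicIE indicE in_setT.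
Qed.

Definition dunit X (a : X) : dist X :=
  exist _ (dunit_fun a) (mem_set (dunit_is_distribution a)).

Lemma mean_dunit X (a : X) (h : X -> I) : mean (dunit a) h = h a.
Proof. by apply: ereal_of_inj; rewrite meanE mean_dunit_fun. Qed.

Definition dmult_fun X (P : dist (dist X)) (x : X) : I := mean P (fun p => p x).

Lemma mean_dmult_fun X (P : dist (dist X)) (h : X -> I) :
  \esum_(x in @setT {classic X}) (ereal_of (dmult_fun P x) * ereal_of (h x)) =
  ereal_of (mean P (fun p => mean p h)).
Proof.
transitivity
  (\esum_(x in @setT {classic X}) \esum_(p in @setT {classic (dist X)})
    (ereal_of (P p) * (ereal_of (dapp p x) * ereal_of (h x)))).
  apply: eq_esum => x _; rewrite meanE muleC -esumZl ?ereal_of_ge0//; last first.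
    by move=> p; rewrite mule_ge0// ereal_of_ge0.
  by apply: eq_esum => p _; rewrite muleC muleA.
rewrite exchange_esum; last by move=> x p; rewrite !mule_ge0// ereal_of_ge0.
rewrite meanE; apply: eq_esum => p _; rewrite esumZl ?ereal_of_ge0 ?meanE// => x.
by rewrite mule_ge0// ereal_of_ge0.
Qed.

Lemma dmult_is_distribution X (P : dist (dist X)) :
  is_distribution (dmult_fun P).
Proof.
apply/is_distribution_indicIT; rewrite mean_dmult_fun -[RHS](mean_indicIT P).
rewrite !meanE; apply: eq_esum => p _.
by rewrite mean_indicIT indicIE indicE in_setT.
Qed.

Definition dmult X (P : dist (dist X)) : dist X :=
  exist _ (dmult_fun P) (mem_set (dmult_is_distribution P)).

Lemma mean_dmult X (P : dist (dist X)) (h : X -> I) :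
  mean (dmult P) h = mean P (fun p => mean p h).
Proof. by apply: ereal_of_inj; rewrite meanE mean_dmult_fun. Qed.

Lemma mean_indicI1 X (p : dist X) (x : X) : mean p (indicI [set x]) = p x.
Proof.
apply: ereal_of_inj; rewrite meanE -(mean_dunit_fun x p).
by apply: eq_esum => y _; rewrite muleC.
Qed.

Lemma dist_ext_mean X (p q : dist X) : (forall h, mean p h = mean q h) -> p = q.
Proof. by move=> pq; apply: dist_ext => x; rewrite -!mean_indicI1 pq. Qed.

Lemma dmap_id X : dmap (@id X) = id.
Proof. by apply/funext => p; apply: dist_ext_mean => h; rewrite mean_dmap. Qed.

Lemma dmap_comp X Y Z (g : Y -> Z) (f : X -> Y) :
  dmap (g \o f) = dmap g \o dmap f.
Proof.
by apply/funext => p; apply: dist_ext_mean => h /=; rewrite !mean_dmap.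
Qed.

Definition dist_functor : functor sets sets :=
  @Functor sets sets dist dmap dmap_id dmap_comp.

Lemma dunit_natural X Y (f : X -> Y) : dmap f \o @dunit X = @dunit Y \o f.
Proof.
by apply/funext => a; apply: dist_ext_mean => h /=; rewrite mean_dmap !mean_dunit.
Qed.

Lemma dmult_natural X Y (f : X -> Y) :
  dmap f \o @dmult X = @dmult Y \o dmap (dmap f).
Proof.
apply/funext => P; apply: dist_ext_mean => h /=.
rewrite mean_dmap !mean_dmult mean_dmap; congr mean.
by apply/funext => p /=; rewrite mean_dmap.
Qed.

Lemma dmult_dmult X :
  @dmult X \o dmap (@dmult X) = @dmult X \o @dmult (dist X).
Proof.
apply/funext => P; apply: dist_ext_mean => h /=.
rewrite !mean_dmult mean_dmap; congr mean.
by apply/funext => p /=; rewrite mean_dmult.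
Qed.

Lemma dmult_dmap_dunit X : @dmult X \o dmap (@dunit X) = id.
Proof.
apply/funext => p; apply: dist_ext_mean => h /=.
rewrite mean_dmult mean_dmap; congr mean.
by apply/funext => x /=; rewrite mean_dunit.
Qed.

Lemma dmult_dunit X : @dmult X \o @dunit (dist X) = id.
Proof.
by apply/funext => p; apply: dist_ext_mean => h /=; rewrite mean_dmult mean_dunit.
Qed.

Definition dist_unit : nat_trans (functor_id sets) dist_functor :=
  @NatTrans sets sets (functor_id sets) dist_functor dunit dunit_natural.

Definition dist_mult :
    nat_trans (functor_comp dist_functor dist_functor) dist_functor :=
  @NatTrans sets sets (functor_comp dist_functor dist_functor) dist_functor
    dmult dmult_natural.

Definition dist_monad : monad sets :=
  @Monad sets dist_functor dist_unit dist_mult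
    dmult_dmult dmult_dmap_dunit dmult_dunit.

End distribution_monad.
Arguments dunit {R X} a.
Arguments dmap {R X Y} f p.
Arguments dmult {R X} P.
Arguments mean {R X} p h.

Section pointed_meas_space.
Local Open Scope ereal_scope.

(* A nonempty space as a (pointed) library measurable type; the choice of the
   point is immaterial. *)
Definition ptd (X : meas_space) (h : $|X|) : Type := X.

Section ptd_instances.
Variables (X : meas_space) (h : $|X|).

Let ptd0 : msets X set0.
Proof. by have [] := msets_sigma_algebra X. Qed.

Let ptdC (A : set X) : msets X A -> msets X (~` A).
Proof. by have [_ + _] := msets_sigma_algebra X => /[apply]; rewrite setTD. Qed.

Let ptdU (F : (set X)^nat) :
  (forall i, msets X (F i)) -> msets X (\bigcup_i F i).
Proof. by have [_ _] := msets_sigma_algebra X; exact. Qed.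

HB.instance Definition _ := gen_eqMixin (ptd h).
HB.instance Definition _ := gen_choiceMixin (ptd h).
HB.instance Definition _ := isPointed.Build (ptd h) (unsquash h).
HB.instance Definition _ := @isMeasurable.Build default_measure_display
  (ptd h) (msets X) ptd0 ptdC ptdU.

End ptd_instances.

Lemma msetsT (X : meas_space) : msets X setT.
Proof.
by have [+ + _] := msets_sigma_algebra X => /[swap] /[apply]; rewrite setTD setC0.
Qed.

Lemma power_measurable (X Y : meas_space) (J : Type) (f : X -> J -> Y) :
  (forall j B, msets Y B -> msets X ((f ^~ j) @^-1` B)) ->
  forall B, msets (power J Y) B -> msets X (f @^-1` B).
Proof.
move=> mf B mB; rewrite -[f @^-1` _]setTI.
suff /(_ _ mB) : msets (power J Y) `<=` image_set_system setT f (msets X) by [].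
apply: smallest_sub; first exact/sigma_algebra_image/msets_sigma_algebra.
move=> _ [j _ [C mC <-]]; rewrite /image_set_system /=.
by rewrite !setTI; exact: mf.
Qed.

Lemma power_app_measurable (Y : meas_space) (J : Type) (j : J) (B : set Y) :
  msets Y B -> msets (power J Y) [set p | B (p j)].
Proof.
move=> mB; apply: sub_sigma_algebra; exists j => //; exists B => //.
by rewrite setTI.
Qed.

Lemma subspace_measurable (X Y : meas_space) (A : set Y) (f : X -> A) :
  (forall B, msets Y B -> msets X ((val \o f) @^-1` B)) ->
  forall B, msets (subspace A) B -> msets X (f @^-1` B).
Proof. by move=> mf _ [C mC <-]; rewrite setTI; exact: mf. Qed.

Lemma subspace_val_measurable (Y : meas_space) (A : set Y) (B : set Y) :
  msets Y B -> msets (subspace A) (val @^-1` B).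
Proof. by move=> mB; exists B => //; rewrite setTI. Qed.

Lemma msets_empty (X : meas_space) (A : set X) : ~ $|X| -> msets X A.
Proof.
move=> X0; suff -> : A = setT by exact: msetsT.
by apply/seteqP; split => // x; exfalso; apply: X0; exact: squash.
Qed.

Variable R : realType.

Lemma unit_interval_measurable (X : meas_space) (f : X -> unit_interval R) :
  (forall h : $|X|, measurable_fun [set: ptd h] (ereal_of \o f)) <->
  forall B, msets (unit_interval R) B -> msets X (f @^-1` B).
Proof.
split => [mf|mf h].
  have [h|X0] := pselect $|X|; last by move=> B _; exact: msets_empty.
  apply: subspace_measurable => B mB.
  have /measurable_EFinP /(_ measurableT B mB) := mf h.
  by rewrite setTI.
apply/measurable_EFinP => _ B mB; rewrite setTI.
exact: (mf _ (@subspace_val_measurable (borel R) _ B mB)).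
Qed.

End pointed_meas_space.

Section countable_distributions.
Variable R : realType.
Local Notation I := (unit_interval R).
Local Open Scope ereal_scope.

Definition kleisli_countable : category :=
  full_subcategory (C := kleisli (dist_monad R))
    (fun X : Type => countable [set: X]).

Definition dist_space (X : Type) : meas_space :=
  @subspace (power X I) (@is_distribution R X).

Lemma mean_measurable (X : Type) (k : X -> I) (h : $|dist_space X|) :
  countable [set: X] ->
  measurable_fun [set: ptd h] (fun p => ereal_of (mean p k)).
Proof.
move=> /countable_injP[e einj].
under eq_fun do rewrite meanE.
pose a (p : dist_space X) n : \bar R :=
  if pselect (exists x, e x = n) is left ex then
    ereal_of (dapp p (sval (cid ex))) * ereal_of (k (sval (cid ex))) else 0.
have a0 p n : 0 <= a p n.
  by rewrite /a; case: pselect => // ex; rewrite mule_ge0 ?ereal_of_ge0.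
have aE p x : a p (e x) = ereal_of (dapp p x) * ereal_of (k x).
  rewrite /a; case: pselect => [ex|[]]; last by exists x.
  by case: cid => y /= /einj ->//; rewrite inE.
rewrite (_ : (fun p => _) = fun p => \sum_(n <oo | n \in predT) a p n).
  apply: ge0_emeasurable_sum => // n _.
  rewrite /a; case: pselect => [ex|_]; last exact: measurable_cst.
  under eq_fun do rewrite muleC.
  apply: measurable_funeM.
  apply: ((unit_interval_measurable (fun p : dist_space X => dapp p _)).2) => B mB.
  exact: (@subspace_val_measurable (power X I) _ _ (power_app_measurable _ mB)).
apply/funext => p; transitivity (\esum_(n in [set: nat]) a p n); last first.
  by rewrite -nneseries_esumT.
transitivity (\esum_(x in @setT {classic X}) a p (e x)).
  by apply: eq_esum => x _; rewrite aE.
rewrite -(esum_image _ (e : {classic X} -> nat)); last by move=> x y _ _ /einj ->; rewrite ?inE.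
rewrite esum_mkcond; apply: eq_esum => n _; case: ifPn => // /negP nr.
rewrite /a; case: pselect => // -[x exn]; exfalso; apply: nr.
by rewrite inE; exists x.
Qed.


Lemma dmult_dmapE X Y (f : X -> dist R Y) (p : dist R X) (y : Y) :
  dmult (dmap f p) y = mean p (fun x => dapp (f x) y).
Proof. by rewrite [LHS]mean_dmap. Qed.

Lemma U_dist_subproof (X Y : kleisli_countable) (f : hom X Y) :
  forall B, msets (dist_space (sval Y)) B ->
    msets (dist_space (sval X)) ((dmult \o dmap f) @^-1` B).
Proof.
apply: (@subspace_measurable _ (power (sval Y) I) _
  (dmult \o dmap f : dist_space (sval X) -> dist_space (sval Y))).
apply: power_measurable => y.
rewrite (_ : (fun p => _) = fun p : dist_space (sval X) =>
    mean p (fun x => dapp (f x) y)); last first.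
  by apply/funext => p; exact: dmult_dmapE.
apply/unit_interval_measurable => h.
by apply: mean_measurable; exact: (svalP X).
Qed.

Definition U_dist_map (X Y : kleisli_countable) (f : hom X Y) :
    meas_map (dist_space (sval X)) (dist_space (sval Y)) :=
  @MeasMap (dist_space (sval X)) (dist_space (sval Y)) (dmult \o dmap f)
    (@U_dist_subproof X Y f).

Lemma U_dist_map1 (X : kleisli_countable) :
  U_dist_map (idm X) = meas_id (dist_space (sval X)).
Proof.
apply: meas_map_ext => p /=.
exact: (congr1 (fun F => F p) (dmult_dmap_dunit R (sval X))).
Qed.

Lemma U_dist_mapM (X Y Z : kleisli_countable) (g : hom Y Z) (f : hom X Y) :
  U_dist_map (g ∘ f)%cat = meas_comp (U_dist_map g) (U_dist_map f).
Proof.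
apply: meas_map_ext => p /=; apply: dist_ext_mean => h.
rewrite !mean_dmult !mean_dmap mean_dmult mean_dmap; congr mean.
by apply/funext => x /=; rewrite mean_dmult mean_dmap.
Qed.

Definition U_dist : functor kleisli_countable Meas :=
  @Functor kleisli_countable Meas (fun X => dist_space (sval X)) U_dist_map
    U_dist_map1 U_dist_mapM.

End countable_distributions.

Section giry_monad.
Variable R : realType.
Local Notation I := (unit_interval R).
Local Open Scope ereal_scope.

(* As a type, [msets X] is the type of the measurable subsets of [X], so that a
   measure is a point of the power of [0, 1] indexed by the sigma-algebra. *)
Definition is_probability (X : meas_space) : set (msets X -> I) :=
  [set p | (forall A : msets X, val A = setT -> ereal_of (p A) = 1) /\
    (forall (F : nat -> msets X) (A : msets X),
      trivIset setT (fun n => val (F n)) -> val A = \bigcup_n val (F n) ->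
      ereal_of (p A) = \sum_(n <oo) ereal_of (p (F n)))].

Definition giry_space (X : meas_space) : meas_space :=
  @subspace (power (msets X) I) (@is_probability X).

Definition gapp (X : meas_space) (P : giry_space X) (A : msets X) : I := val P A.

Definition mset_of (X : meas_space) (A : set X) (mA : msets X A) : msets X :=
  exist _ A (mem_set mA).

Lemma giry_ext (X : meas_space) (P Q : giry_space X) :
  (forall A, ereal_of (gapp P A) = ereal_of (gapp Q A)) -> P = Q.
Proof. by move=> PQ; apply/val_inj/funext => A; exact/ereal_of_inj/PQ. Qed.

Lemma gapp_setT (X : meas_space) (P : giry_space X) (A : msets X) :
  val A = setT -> ereal_of (gapp P A) = 1.
Proof. by have /set_mem[+ _] := valP P; exact. Qed.

Lemma gapp_bigcup (X : meas_space) (P : giry_space X) (F : nat -> msets X)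
    (A : msets X) :
  trivIset setT (fun n => val (F n)) -> val A = \bigcup_n val (F n) ->
  ereal_of (gapp P A) = \sum_(n <oo) ereal_of (gapp P (F n)).
Proof. by have /set_mem[_] := valP P; exact. Qed.

Lemma gapp_set0 (X : meas_space) (P : giry_space X) (A : msets X) :
  val A = set0 -> ereal_of (gapp P A) = 0.
Proof.
move=> A0; have := @gapp_bigcup X P (fun=> A) A.
rewrite A0 bigcup0// => /(_ _ erefl) PA.
have {PA} PA : ereal_of (gapp P A) = \sum_(n <oo) ereal_of (gapp P A).
  by apply: PA; apply/trivIsetP => *; rewrite set0I.
have := @nneseries_lim_ge R (fun=> ereal_of (gapp P A)) xpredT 0 2
  (fun _ _ _ => ereal_of_ge0 _).
rewrite -PA !big_nat_recr//= big_geq// add0e.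
have := ereal_of_ge0 (gapp P A); rewrite /ereal_of -EFinD !lee_fin => x0 x2.
by congr EFin; lra.
Qed.

Lemma giry_inhabited (X : meas_space) (P : giry_space X) : $|X|.
Proof.
have [//|X0] := pselect $|X|.
have T0 : [set: X] = set0.
  by apply/seteqP; split => // x _; apply: X0; exact: squash.
have := @gapp_set0 X P (mset_of (msetsT X)) T0.
by rewrite gapp_setT// => /eqP; rewrite onee_eq0.
Qed.

Section prob_measure.
Variables (X : meas_space) (h : $|X|) (P : giry_space X).

(* The library measure extending [P] by 0 to the non-measurable sets. *)
Definition prob_measure (A : set (ptd h)) : \bar R :=
  if pselect (msets X A) is left mA then ereal_of (gapp P (mset_of mA)) else 0.

Lemma prob_measureE (A : set (ptd h)) (mA : msets X A) :
  prob_measure A = ereal_of (gapp P (mset_of mA)).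
Proof.
rewrite /prob_measure; case: pselect => // mA'.
by rewrite (Prop_irrelevance mA mA').
Qed.

Let prob_measure0 : prob_measure set0 = 0.
Proof.
by rewrite (prob_measureE (@measurable0 _ (ptd h))) gapp_set0.
Qed.

Let prob_measure_ge0 A : 0 <= prob_measure A.
Proof. by rewrite /prob_measure; case: pselect => // mA; exact: ereal_of_ge0. Qed.

Let prob_measure_sigma_additive : semi_sigma_additive prob_measure.
Proof.
move=> F mF tF mUF.
rewrite (prob_measureE mUF) (@gapp_bigcup _ _ (fun n => mset_of (mF n)))//.
rewrite (_ : (fun n => \sum_(0 <= i < n) prob_measure (F i)) =
    (fun n => \sum_(0 <= i < n) ereal_of (gapp P (mset_of (mF i))))).
  by apply: is_cvg_nneseries => n _ _; exact: ereal_of_ge0.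
by apply/funext => n; apply: eq_bigr => i _; exact: prob_measureE.
Qed.

HB.instance Definition _ := isMeasure.Build _ _ _ prob_measure
  prob_measure0 prob_measure_ge0 prob_measure_sigma_additive.

Let prob_measureT : prob_measure setT = 1.
Proof. by rewrite (prob_measureE (msetsT X)) gapp_setT. Qed.

HB.instance Definition _ :=
  Measure_isProbability.Build _ _ _ prob_measure prob_measureT.

Lemma integral_prob_measure_cst1 : \int[prob_measure]_x cst 1 x = 1.
Proof. by rewrite integral_cst// mul1e; exact: prob_measureT. Qed.

End prob_measure.
Arguments prob_measure {X} h P A.

Definition gint (X : meas_space) (P : giry_space X) (f : X -> \bar R) : \bar R :=
  \int[prob_measure (giry_inhabited P) P]_x f x.

Lemma gintE (X : meas_space) (h : $|X|) (P : giry_space X) (f : X -> \bar R) :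
  gint P f = \int[prob_measure h P]_x f x.
Proof. by rewrite /gint (Prop_irrelevance (giry_inhabited P) h). Qed.

Lemma gapp_measurable (X : meas_space) (A : msets X) B :
  msets I B -> msets (giry_space X) ((fun P => gapp P A) @^-1` B).
Proof.
move=> mB.
exact: (@subspace_val_measurable (power _ I) _ _ (power_app_measurable _ mB)).
Qed.

Lemma gapp_measurable_fun (X : meas_space) (A : msets X)
    (h : $|giry_space X|) :
  measurable_fun [set: ptd h] (fun P => ereal_of (gapp P A)).
Proof.
apply: (unit_interval_measurable (fun P : giry_space X => gapp P A)).2.
exact: gapp_measurable.
Qed.

Section to_giry.
Variables (X : meas_space) (h : $|X|) (hG : $|giry_space X|).

(* [giry.giry] is the library's space of subprobability measures. *)
Definition to_giry (P : ptd hG) : giry.giry (ptd h) R := prob_measure h P.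

Lemma to_giry_measurable : measurable_fun [set: ptd hG] to_giry.
Proof.
apply: giry.measurable_giry_codensity => // B mB.
rewrite (_ : (fun P => _) = fun P => ereal_of (gapp P (mset_of mB))).
  exact: gapp_measurable_fun.
by apply/funext => P; exact: prob_measureE.
Qed.

Lemma gint_measurable (f : X -> \bar R) :
  measurable_fun [set: ptd h] f -> (forall x, 0 <= f x) ->
  measurable_fun [set: ptd hG] (fun P => gint P f).
Proof.
move=> mf f0; under eq_fun do rewrite (gintE h).
exact: (measurableT_comp (giry.measurable_giry_int mf f0) to_giry_measurable).
Qed.

End to_giry.

Section giry_functor.
Variables (X Y : meas_space) (f : meas_map X Y).

Definition mset_preimage (B : msets Y) : msets X :=
  mset_of (mmapP f (set_mem (valP B))).

Definition gmap_fun (P : giry_space X) (B : msets Y) : I :=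
  gapp P (mset_preimage B).

Lemma gmap_is_probability (P : giry_space X) :
  is_probability (gmap_fun P).
Proof.
split => [A AT|F A tF AE]; first by rewrite gapp_setT//= AT.
rewrite (@gapp_bigcup _ P (fun n => mset_preimage (F n)))//=.
  apply/trivIsetP => i j _ _ ij; rewrite -preimage_setI.
  by move/trivIsetP : tF => ->//; rewrite preimage_set0.
by rewrite AE preimage_bigcup.
Qed.

Definition gmap (P : giry_space X) : giry_space Y :=
  exist _ (gmap_fun P) (mem_set (gmap_is_probability P)).

Lemma gmap_measurable B :
  msets (giry_space Y) B -> msets (giry_space X) (gmap @^-1` B).
Proof.
apply: (@subspace_measurable _ (power (msets Y) I) _ gmap).
by apply: power_measurable => A C mC; exact: (gapp_measurable _ mC).
Qed.

Definition giry_hom : meas_map (giry_space X) (giry_space Y) :=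
  MeasMap gmap_measurable.

Lemma ptd_measurable (hX : $|X|) (hY : $|Y|) :
  measurable_fun [set: ptd hX] (f : ptd hX -> ptd hY).
Proof. by move=> _ B mB; rewrite setTI; exact: mmapP. Qed.

Lemma gint_gmap (hY : $|Y|) (P : giry_space X) (k : Y -> \bar R) :
  measurable_fun [set: ptd hY] k -> (forall y, 0 <= k y) ->
  gint (gmap P) k = gint P (k \o f).
Proof.
move=> mk k0; pose hX := giry_inhabited P.
rewrite (gintE hY) (gintE hX).
transitivity (giry.giry_int
    (giry.giry_map (@ptd_measurable hX hY) (prob_measure hX P)) k); last first.
  exact: giry.giry_int_map.
apply: eq_measure_integral => A mA _.
rewrite [LHS](prob_measureE _ mA) /=.
rewrite /giry.giry_map /= /pushforward (prob_measureE _ (mmapP f mA)).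
by congr ereal_of; congr (gapp P _); exact/val_inj.
Qed.

End giry_functor.

Section giry_unit.
Variable X : meas_space.

Definition gdirac_fun (x : X) (A : msets X) : I := indicI R (val A) x.

Lemma gdirac_is_probability (x : X) : is_probability (gdirac_fun x).
Proof.
split => [A AT|F A tF AE]; first by rewrite indicIE AT indicT.
rewrite indicIE AE.
have mF n : @measurable _ (ptd (squash x)) (val (F n)).
  exact: (set_mem (valP (F n))).
have UF := @measure_sigma_additive _ R _
  (dirac (x : ptd (squash x))) _ mF tF.
transitivity (dirac (x : ptd (squash x)) (\bigcup_n val (F n)) : \bar R) => //.
rewrite -(cvg_lim _ UF)//; apply: eq_eseriesr => n _; rewrite indicIE.
Qed.

Definition gdirac (x : X) : giry_space X :=
  exist _ (gdirac_fun x) (mem_set (gdirac_is_probability x)).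

Lemma gdirac_measurable B : msets (giry_space X) B -> msets X (gdirac @^-1` B).
Proof.
apply: (@subspace_measurable _ (power (msets X) I) _ gdirac).
apply: power_measurable => A; apply/unit_interval_measurable => h.
rewrite (_ : _ \o _ = EFin \o (\1_(val A) : ptd h -> R)).
  by apply/measurable_EFinP/measurable_indic; exact: (set_mem (valP A)).
by apply/funext => x /=; rewrite indicIE.
Qed.

Definition giry_unit_hom : meas_map X (giry_space X) :=
  MeasMap gdirac_measurable.

Lemma gint_dirac (h : $|X|) (x : X) (k : X -> \bar R) :
  measurable_fun [set: ptd h] k -> gint (gdirac x) k = k x.
Proof.
move=> mk; rewrite (gintE h).
transitivity (\int[(dirac (x : ptd h) : measure _ R)]_y k y).
  apply: eq_measure_integral => A mA _.
  by rewrite [LHS](prob_measureE _ mA) /= [LHS]indicIE.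
by rewrite integral_dirac// diracT mul1e.
Qed.

End giry_unit.

Section giry_mult.
Variable X : meas_space.

Lemma gapp_msetE (P : giry_space X) (A : msets X) (mA : msets X (val A)) :
  gapp P (mset_of mA) = gapp P A.
Proof. by congr (gapp P _); exact/val_inj. Qed.

Lemma gint01 (M : giry_space (giry_space X)) (A : msets X) :
  0 <= gint M (fun P => ereal_of (gapp P A)) <= 1.
Proof.
pose h := giry_inhabited M.
rewrite (gintE h) integral_ge0 => [/=|P _]; last exact: ereal_of_ge0.
apply: (@le_trans _ _ (\int[prob_measure h M]_P cst 1 P)).
  apply: ge0_le_integral => //.
  - by move=> P _; exact: ereal_of_ge0.
  - exact: gapp_measurable_fun.
  - by move=> P _; exact: ereal_of_le1.
by rewrite integral_prob_measure_cst1.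
Qed.

Definition gjoin_fun (M : giry_space (giry_space X)) (A : msets X) : I :=
  of_ereal (gint01 M A).

Lemma gjoin_is_probability M : is_probability (gjoin_fun M).
Proof.
pose h := giry_inhabited M.
split => [A AT|F A tF AE]; rewrite of_erealK (gintE h).
  transitivity (\int[prob_measure h M]_P cst 1 P).
    by apply: eq_integral => P _; rewrite gapp_setT.
  by rewrite integral_prob_measure_cst1.
under eq_integral do rewrite (gapp_bigcup _ tF AE).
rewrite integral_nneseries//.
- by apply: eq_eseriesr => n _; rewrite of_erealK (gintE h).
- by move=> n; exact: gapp_measurable_fun.
- by move=> n P _; exact: ereal_of_ge0.
Qed.

Definition gjoin (M : giry_space (giry_space X)) : giry_space X :=
  exist _ (gjoin_fun M) (mem_set (gjoin_is_probability M)).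

Lemma gjoinE M (A : msets X) :
  ereal_of (gapp (gjoin M) A) = gint M (fun P => ereal_of (gapp P A)).
Proof. exact: of_erealK. Qed.

Lemma gjoin_measurable B :
  msets (giry_space X) B -> msets (giry_space (giry_space X)) (gjoin @^-1` B).
Proof.
apply: (@subspace_measurable _ (power (msets X) I) _ gjoin).
apply: power_measurable => A; apply/unit_interval_measurable => h.
rewrite (_ : _ \o _ = fun M => gint M (fun P => ereal_of (gapp P A))).
  apply: (@gint_measurable _ (giry_inhabited (unsquash h))).
    exact: gapp_measurable_fun.
  by move=> P; exact: ereal_of_ge0.
by apply/funext => M /=; exact: gjoinE.
Qed.

Definition giry_mult_hom : meas_map (giry_space (giry_space X)) (giry_space X) :=
  MeasMap gjoin_measurable.

Lemma gint_gjoin (h : $|X|) M (k : X -> \bar R) :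
  measurable_fun [set: ptd h] k -> (forall x, 0 <= k x) ->
  gint (gjoin M) k = gint M (fun P => gint P k).
Proof.
move=> mk k0; pose hG := giry_inhabited M.
rewrite (gintE h) (gintE hG).
pose M' := giry.giry_map (@to_giry_measurable X h hG) (prob_measure hG M).
transitivity (giry.giry_int (giry.giry_join M') k).
  apply: eq_measure_integral => A mA _.
  rewrite [LHS](prob_measureE _ mA) gjoinE (gintE hG).
  rewrite [RHS]giry.giry_int_map//; last exact: giry.measurable_giry_ev.
  by apply: eq_integral => P _; rewrite /= [RHS](prob_measureE _ mA).
rewrite giry.giry_int_join// giry.giry_int_map//.
- by apply: eq_integral => P _; rewrite (gintE h).
- exact: giry.measurable_giry_int.
- by move=> P; exact: integral_ge0.
Qed.

End giry_mult.

Lemma giry_hom1 (X : meas_space) : giry_hom (meas_id X) = meas_id (giry_space X).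
Proof.
apply: meas_map_ext => P; apply: giry_ext => A /=.
by congr ereal_of; congr (gapp P _); exact/val_inj.
Qed.

Lemma giry_homM (X Y Z : meas_space) (g : meas_map Y Z) (f : meas_map X Y) :
  giry_hom (meas_comp g f) = meas_comp (giry_hom g) (giry_hom f).
Proof.
apply: meas_map_ext => P; apply: giry_ext => A /=.
by congr ereal_of; congr (gapp P _); exact/val_inj.
Qed.

Definition giry_functor : functor Meas Meas :=
  @Functor Meas Meas giry_space giry_hom giry_hom1 giry_homM.

Lemma giry_unit_natural (X Y : meas_space) (f : meas_map X Y) :
  meas_comp (giry_hom f) (giry_unit_hom X) = meas_comp (giry_unit_hom Y) f.
Proof.
by apply: meas_map_ext => x; apply: giry_ext => A /=; rewrite !indicIE.
Qed.

Definition giry_unit : nat_trans (functor_id Meas) giry_functor :=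
  @NatTrans Meas Meas (functor_id Meas) giry_functor giry_unit_hom
    giry_unit_natural.

Lemma giry_mult_natural (X Y : meas_space) (f : meas_map X Y) :
  meas_comp (giry_hom f) (giry_mult_hom X) =
  meas_comp (giry_mult_hom Y) (giry_hom (giry_hom f)).
Proof.
apply: meas_map_ext => M; apply: giry_ext => B /=.
rewrite [LHS]gjoinE gjoinE.
rewrite (@gint_gmap _ _ _ (squash (gmap f (unsquash (giry_inhabited M)))))//.
- exact: gapp_measurable_fun.
- by move=> P; exact: ereal_of_ge0.
Qed.

Definition giry_mult :
    nat_trans (functor_comp giry_functor giry_functor) giry_functor :=
  @NatTrans Meas Meas (functor_comp giry_functor giry_functor) giry_functor
    giry_mult_hom giry_mult_natural.

Lemma giry_multA (X : meas_space) :
  meas_comp (giry_mult_hom X) (giry_hom (giry_mult_hom X)) =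
  meas_comp (giry_mult_hom X) (giry_mult_hom (giry_space X)).
Proof.
apply: meas_map_ext => M; apply: giry_ext => A /=.
have hG : $|giry_space X|.
  by exact: (squash (gjoin (unsquash (giry_inhabited M)))).
rewrite !gjoinE (@gint_gmap _ _ _ (hG)); last 2 first.
- exact: gapp_measurable_fun.
- by move=> P; exact: ereal_of_ge0.
rewrite (@gint_gjoin _ (hG)); last 2 first.
- exact: gapp_measurable_fun.
- by move=> P; exact: ereal_of_ge0.
by congr gint; apply/funext => P /=; rewrite gjoinE.
Qed.

Lemma giry_mult_fmap_unit (X : meas_space) :
  meas_comp (giry_mult_hom X) (giry_hom (giry_unit_hom X)) =
  meas_id (giry_space X).
Proof.
apply: meas_map_ext => P; apply: giry_ext => A /=.
pose h := giry_inhabited P.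
rewrite gjoinE (@gint_gmap _ _ _ (squash P)); last 2 first.
- exact: gapp_measurable_fun.
- by move=> Q; exact: ereal_of_ge0.
rewrite (gintE h).
transitivity (\int[prob_measure h P]_(x in setT) (\1_(val A) x)%:E).
  by apply: eq_integral => x _ /=; rewrite [LHS]indicIE.
have mA := set_mem (valP A).
rewrite integral_indic// setIT [LHS](prob_measureE _ mA).
by rewrite gapp_msetE.
Qed.

Lemma giry_mult_unit (X : meas_space) :
  meas_comp (giry_mult_hom X) (giry_unit_hom (giry_space X)) =
  meas_id (giry_space X).
Proof.
apply: meas_map_ext => P; apply: giry_ext => A /=.
rewrite gjoinE (@gint_dirac _ (squash P))//.
exact: gapp_measurable_fun.
Qed.

Definition giry_monad : monad Meas :=
  @Monad Meas giry_functor giry_unit giry_mult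
    giry_multA giry_mult_fmap_unit giry_mult_unit.

End giry_monad.

(* Main.v *)
Require Import Defs.
From mathcomp Require Import all_boot all_order all_algebra.
From mathcomp Require Import all_classical all_reals all_analysis.
From mathcomp Require Import measurable_realfun lra.
(* Imported again: [hom], [comp], [indicI] and others are shadowed by MathComp. *)
Require Import Defs.

(** The counit of the Kan extension sends a measure [M] on [D X] to its
barycenter [x |-> \int p x dM(p)].  Conversely, let [s : H U => U] be natural.
A measurable [f : Z -> [0, 1]] is a map [Z -> D 2], so [t : H Z] yields a number
[E_t f := s (H f t)], the probability of success.  Naturality of [s] along
Kleisli maps shows that [E_t (z |-> \sum_x g z x * w x) = \sum_x s (H g t) x * w x]
for every measurable [g : Z -> D X]; hence [E_t] is countably additive,
homogeneous and maps 1 to 1.  So [A |-> E_t 1_A] is a probability measure,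
and [E_t f] is the integral of [f], since [f] is a countable combination of
indicators by its dyadic expansion.  This measure is the only possible value of
the lift at [t], because the barycenter of a measure pushed forward along
[1_A : Z -> D 2] is its value at [A].  Finally the Giry unit and multiplication
satisfy the equations that define those of the codensity monad. *)

Set Implicit Arguments.
Unset Strict Implicit.
Unset Printing Implicit Defensive.
Import Order.TTheory GRing.Theory Num.Theory.
Import numFieldNormedType.Exports.

Local Open Scope classical_set_scope.
Local Open Scope ring_scope.
Local Open Scope ereal_scope.

(** * Sums over countable sets as series *)

Section countable_sums.
Variable R : realType.

(** Extension by zero along an enumeration [e], which reduces integrals of sums over a countable set
    to monotone convergence for series. *)
Definition pad (X : Type) (e : X -> nat) (a : X -> \bar R) (n : nat) : \bar R :=
  if pselect (exists x, e x = n) is left ex then a (sval (cid ex)) else 0.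

Lemma pad_ge0 X (e : X -> nat) (a : X -> \bar R) n :
  (forall x, 0 <= a x) -> 0 <= pad e a n.
Proof. by rewrite /pad; case: pselect. Qed.

Lemma padE X (e : X -> nat) (a : X -> \bar R) x :
  injective e -> pad e a (e x) = a x.
Proof.
move=> einj; rewrite /pad; case: pselect => [ex|[]]; last by exists x.
by case: cid => y /= /einj ->.
Qed.

Lemma esum_pad X (e : X -> nat) (a : X -> \bar R) :
  injective e -> (forall x, 0 <= a x) ->
  \esum_(x in @setT {classic X}) a x = \sum_(n <oo) pad e a n.
Proof.
move=> einj a0; rewrite nneseries_esumT; last by move=> n; exact: pad_ge0.
transitivity (\esum_(x in @setT {classic X}) pad e a (e x)).
  by apply: eq_esum => x _; rewrite padE.
rewrite -(esum_image _ (e : {classic X} -> nat)); last by move=> x y _ _ /einj.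
rewrite esum_mkcond; apply: eq_esum => n _; case: ifPn => // /negP nr.
rewrite /pad; case: pselect => // -[x exn]; exfalso; apply: nr.
by rewrite inE; exists x.
Qed.

(** The choice structure on [{classic nat}] is not the one on [nat]; padding along [id] bridges the
    two. *)
Lemma esum_classic_nat (a : nat -> \bar R) : (forall n, 0 <= a n) ->
  \esum_(n in @setT {classic nat}) a n = \sum_(n <oo) a n.
Proof.
move=> a0; rewrite (@esum_pad _ id)//; apply: eq_eseriesr => n _.
exact: (@padE _ id).
Qed.

Lemma countable_inj X : countable [set: X] -> exists e : X -> nat, injective e.
Proof.
by move=> /countable_injP[e einj]; exists e => x y; apply: einj; rewrite inE.
Qed.

Lemma integral_esum d (T : measurableType d) (mu : {measure set T -> \bar R})
    (X : Type) (a : X -> T -> \bar R) : countable [set: X] ->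
  (forall x, measurable_fun setT (a x)) -> (forall x t, 0 <= a x t) ->
  \int[mu]_t (\esum_(x in @setT {classic X}) a x t) =
  \esum_(x in @setT {classic X}) \int[mu]_t a x t.
Proof.
move=> /countable_inj[e einj] ma a0.
under eq_integral do rewrite (esum_pad einj)//.
rewrite (esum_pad einj) => [|x]; last exact: integral_ge0.
rewrite integral_nneseries//.
- apply: eq_eseriesr => n _; rewrite /pad; case: pselect => // _.
  by rewrite integral0.
- by move=> n; rewrite /pad; case: pselect => // _; exact: measurable_cst.
- by move=> n t _; exact: pad_ge0.
Qed.

End countable_sums.

(** * Distributions on the natural numbers *)

Section distributions_on_nat.
Variable R : realType.
Local Notation I := (unit_interval R).

Lemma mulI01 (s t : I) : 0 <= ereal_of s * ereal_of t <= 1.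
Proof.
rewrite mule_ge0 ?ereal_of_ge0//= -[leRHS]mule1.
by rewrite lee_pmul ?ereal_of_ge0 ?ereal_of_le1.
Qed.

Definition mulI (s t : I) : I := of_ereal (mulI01 s t).

Lemma mulIE s t : ereal_of (mulI s t) = ereal_of s * ereal_of t.
Proof. exact: of_erealK. Qed.

Lemma mean_mulI X (p : dist R X) (c : I) (w : X -> I) :
  ereal_of (mean p (fun x => mulI c (w x))) = ereal_of c * ereal_of (mean p w).
Proof.
rewrite !meanE -esumZl ?ereal_of_ge0//; last first.
  by move=> x; rewrite mule_ge0 ?ereal_of_ge0.
by apply: eq_esum => x _; rewrite mulIE muleCA.
Qed.

Lemma mean_nat (p : dist R nat) (w : nat -> I) :
  ereal_of (mean p w) = \sum_(n <oo) ereal_of (p n) * ereal_of (w n).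
Proof.
by rewrite meanE esum_classic_nat// => n; rewrite mule_ge0 ?ereal_of_ge0.
Qed.

Lemma nneseries_recl_shift (a : nat -> \bar R) : (forall n, 0 <= a n) ->
  \sum_(n <oo) a n = a 0%N + \sum_(n <oo) a n.+1.
Proof.
move=> a0; rewrite nneseries_recl//; congr (_ + _).
by rewrite -(nneseries_addn 1)//; apply: eq_eseriesr => n _; rewrite addn1.
Qed.

Section tail_dist.
Variables (q : nat -> I) (q1 : \sum_(n <oo) ereal_of (q n) <= 1).

Let q01 : 0 <= \sum_(n <oo) ereal_of (q n) <= 1.
Proof. by rewrite nneseries_ge0//= => n _ _; exact: ereal_of_ge0. Qed.

Lemma tail_dist0_subproof : 0 <= 1 - \sum_(n <oo) ereal_of (q n) <= 1.
Proof.
have /andP[s0 s1] := q01; rewrite sube_ge0 ?s1//=.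
  by rewrite leeBlDr ?(fin_num01 q01)// -[leLHS]adde0 leeD2l.
by rewrite (fin_num01 q01).
Qed.

(** The missing mass goes to 0, so that a sequence of functions with sum at most 1 can be coded as a
    single map into distributions on [nat]. *)
Definition tail_dist_fun (n : nat) : I :=
  if n is m.+1 then q m else of_ereal tail_dist0_subproof.

Lemma tail_dist_is_distribution : is_distribution tail_dist_fun.
Proof.
rewrite /is_distribution /= (esum_classic_nat (a := ereal_of \o _)); last first.
  by move=> n; exact: ereal_of_ge0.
rewrite nneseries_recl_shift => [|n]; last exact: ereal_of_ge0.
by rewrite /= of_erealK subeK// (fin_num01 q01).
Qed.

Definition tail_dist : dist R nat :=
  exist _ tail_dist_fun (mem_set tail_dist_is_distribution).

(** Total mass 1 forces the value at 0. *)
Lemma tail_dist_uniq (p : dist R nat) : (forall n, p n.+1 = q n) -> p = tail_dist.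
Proof.
move=> pq; apply: dist_ext => -[|n]; last by rewrite pq.
rewrite [RHS]of_erealK; have := dist_sum1 p.
rewrite (esum_classic_nat (a := fun n => ereal_of (p n))); last first.
  by move=> n; exact: ereal_of_ge0.
rewrite nneseries_recl_shift => [<-|n]; last exact: ereal_of_ge0.
under [X in _ = _ + X - _]eq_eseriesr do rewrite pq.
by rewrite addeK// (fin_num01 q01).
Qed.

End tail_dist.

Definition zeroI : I := indicI R set0 (tt : unit).

Lemma zeroIE : ereal_of zeroI = 0.
Proof. by rewrite indicIE indicE in_set0. Qed.

Definition head_seq (t : I) (n : nat) : I := if n is 0%N then t else zeroI.

Lemma head_seq_le1 t : \sum_(n <oo) ereal_of (head_seq t n) <= 1.
Proof.
rewrite nneseries_recl_shift => [|n]; last exact: ereal_of_ge0.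
rewrite eseries0 ?adde0 ?ereal_of_le1// => n _ _; exact: zeroIE.
Qed.

(* The Bernoulli distribution, with [1%N] as the successful outcome. *)
Definition bern (t : I) : dist R nat := tail_dist (head_seq_le1 t).

Lemma bern_uniq t (p : dist R nat) :
  p 1%N = t -> (forall n, p n.+2 = zeroI) -> p = bern t.
Proof. by move=> p1 p2; apply: tail_dist_uniq => -[|n] /=. Qed.

End distributions_on_nat.

(** * Measurable maps into the unit interval and into spaces of distributions *)

Section spaces.
Variable R : realType.
Local Notation I := (unit_interval R).

Lemma dapp_measurable X (x : X) B :
  msets I B -> msets (dist_space R X) ((fun p : dist R X => p x) @^-1` B).
Proof.
by move=> mB; exact: (@subspace_val_measurable (power X I) _ _ (power_app_measurable _ mB)).
Qed.

Definition dapp_map X (x : X) : meas_map (dist_space R X) I :=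
  @MeasMap (dist_space R X) I (fun p : dist R X => p x) (@dapp_measurable X x).

Lemma dist_space_measurable (Z : meas_space) X (g : Z -> dist R X) :
  (forall x B, msets I B -> msets Z ((fun z => g z x) @^-1` B)) ->
  forall B, msets (dist_space R X) B -> msets Z (g @^-1` B).
Proof.
move=> mg; apply: (@subspace_measurable Z (power X I) _ (g : Z -> dist_space R X)).
by apply: power_measurable => x B mB; exact: mg.
Qed.

Section tail_map.
Variables (Z : meas_space) (F : nat -> meas_map Z I).
Hypothesis F1 : forall z, \sum_(n <oo) ereal_of (F n z) <= 1.

Lemma tail_map_subproof B :
  msets (dist_space R nat) B -> msets Z ((fun z => tail_dist (F1 z)) @^-1` B).
Proof.
(* The coordinate [n.+1] is [F n]; the coordinate 0 is one minus a measurable series. *)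
apply: dist_space_measurable => -[|n]; last exact: mmapP.
apply/unit_interval_measurable => h.
rewrite (_ : _ \o _ = fun z => 1 - \sum_(n <oo) ereal_of (F n z)); last first.
  by apply/funext => z /=; rewrite [LHS]of_erealK.
apply: emeasurable_funB; first exact: measurable_cst.
apply: (@ge0_emeasurable_sum _ _ R setT (fun n (z : ptd h) => ereal_of (F n z)) predT) => n.
  by move=> z _ _; exact: ereal_of_ge0.
move=> _; exact: ((unit_interval_measurable (F n)).2 (@mmapP _ _ (F n)) h).
Qed.

Definition tail_map : meas_map Z (dist_space R nat) := MeasMap tail_map_subproof.

End tail_map.

Lemma cst_measurable (Z Y : meas_space) (y : Y) B :
  msets Y B -> msets Z ((fun=> y) @^-1` B).
Proof.
move=> _; have [By|nBy] := pselect (B y).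
  by rewrite (_ : _ @^-1` _ = setT); [exact: msetsT|apply/seteqP; split].
rewrite (_ : _ @^-1` _ = set0); first by have [] := msets_sigma_algebra Z.
by apply/seteqP; split.
Qed.

Definition cst_map (Z Y : meas_space) (y : Y) : meas_map Z Y :=
  MeasMap (@cst_measurable Z Y y).

Lemma bern_measurable B : msets (dist_space R nat) B -> msets I (@bern R @^-1` B).
Proof.
(* [bern] is the tail map of the identity followed by zeros. *)
pose F n : meas_map I I := if n is 0%N then meas_id I else cst_map I (zeroI R).
have F1 z : \sum_(n <oo) ereal_of (F n z) <= 1.
  apply: le_trans (head_seq_le1 z).
  by rewrite le_eqVlt (eq_eseriesr (g := fun n => ereal_of (head_seq z n))) ?eqxx// => -[|n].
rewrite (_ : @bern R = tail_map F1); first exact: mmapP.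
by apply/funext => z; symmetry; apply: bern_uniq.
Qed.

Definition bern_map : meas_map I (dist_space R nat) := MeasMap bern_measurable.

Lemma indic_measurable (Z : meas_space) (A : msets Z) B :
  msets I B -> msets Z (indicI R (val A) @^-1` B).
Proof.
(* The indicator of [A] is the Dirac map followed by evaluation at [A]. *)
move=> mB; rewrite (_ : _ @^-1` _ = giry_unit_hom R Z @^-1` ((fun P => gapp P A) @^-1` B))//.
by apply: mmapP; exact: gapp_measurable.
Qed.

Definition indic_map (Z : meas_space) (A : msets Z) : meas_map Z I :=
  MeasMap (@indic_measurable Z A).

Lemma mulI_measurable (Z : meas_space) (c : I) (f : meas_map Z I) B :
  msets I B -> msets Z ((fun z => mulI c (f z)) @^-1` B).
Proof.
move: B; apply/unit_interval_measurable => h.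
rewrite (_ : _ \o _ = fun z => ereal_of c * ereal_of (f z)); last first.
  by apply/funext => z /=; rewrite mulIE.
apply: measurable_funeM.
exact: ((unit_interval_measurable f).2 (@mmapP _ _ f) h).
Qed.

Definition mulI_map (Z : meas_space) (c : I) (f : meas_map Z I) : meas_map Z I :=
  MeasMap (@mulI_measurable Z c f).

End spaces.

(** * Barycenters, the counit of the Kan extension *)

Section barycenter.
Variable R : realType.
Local Notation I := (unit_interval R).

Lemma meas_map_measurable_fun (Z : meas_space) (h : $|Z|) (f : meas_map Z I) :
  measurable_fun [set: ptd h] (fun z : ptd h => ereal_of (f z)).
Proof. exact: ((unit_interval_measurable f).2 (@mmapP _ _ f) h). Qed.

Lemma gintI01 (Z : meas_space) (M : giry_space R Z) (f : meas_map Z I) :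
  0 <= gint M (fun z => ereal_of (f z)) <= 1.
Proof.
pose h := giry_inhabited M.
rewrite (gintE h) integral_ge0 => [/=|z _]; last exact: ereal_of_ge0.
apply: (@le_trans _ _ (\int[@prob_measure R Z h M]_z cst 1 z)).
  apply: ge0_le_integral => //.
  - by move=> z _; exact: ereal_of_ge0.
  - exact: meas_map_measurable_fun.
  - by move=> z _; exact: ereal_of_le1.
by rewrite integral_prob_measure_cst1.
Qed.

Definition gintI (Z : meas_space) (M : giry_space R Z) (f : meas_map Z I) : I :=
  of_ereal (gintI01 M f).

Lemma gintIE (Z : meas_space) (M : giry_space R Z) (f : meas_map Z I) :
  ereal_of (gintI M f) = gint M (fun z => ereal_of (f z)).
Proof. exact: of_erealK. Qed.

Section countable_set.
Variables (X : Type) (cX : countable [set: X]).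

Definition bary_fun (M : giry_space R (dist_space R X)) (x : X) : I :=
  gintI M (dapp_map R x).

(** As [X] is countable, monotone convergence exchanges the integral with the sum. The weight 1 then
    gives a barycenter total mass 1, and general weights give naturality of the counit. *)
Lemma mean_bary_fun (M : giry_space R (dist_space R X)) (w : X -> I) :
  \esum_(x in @setT {classic X}) (ereal_of (bary_fun M x) * ereal_of (w x)) =
  gint M (fun p => ereal_of (mean p w)).
Proof.
pose h := giry_inhabited M.
rewrite (gintE h); under [RHS]eq_integral do rewrite meanE.
rewrite integral_esum//.
- apply: eq_esum => x _; rewrite gintIE (gintE h) ge0_integralZr ?ereal_of_ge0//.
    exact: (@meas_map_measurable_fun _ h (dapp_map R x)).
  by move=> p _; exact: ereal_of_ge0.
- move=> x; apply: emeasurable_funM; last exact: measurable_cst.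
  exact: (@meas_map_measurable_fun _ h (dapp_map R x)).
- by move=> x p; rewrite mule_ge0 ?ereal_of_ge0.
Qed.

Lemma bary_is_distribution M : is_distribution (bary_fun M).
Proof.
apply/is_distribution_indicIT; rewrite mean_bary_fun.
rewrite -[RHS](integral_prob_measure_cst1 (giry_inhabited M) M).
by apply: eq_integral => p _; rewrite mean_indicIT.
Qed.

Definition bary (M : giry_space R (dist_space R X)) : dist R X :=
  exist _ (bary_fun M) (mem_set (bary_is_distribution M)).

Lemma mean_bary M w :
  ereal_of (mean (bary M) w) = gint M (fun p => ereal_of (mean p w)).
Proof. by rewrite meanE mean_bary_fun. Qed.

Lemma bary_measurable B : msets (dist_space R X) B ->
  msets (giry_space R (dist_space R X)) (bary @^-1` B).
Proof.
apply: dist_space_measurable => x; apply/unit_interval_measurable => h.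
rewrite (_ : _ \o _ = fun M : giry_space R (dist_space R X) =>
    gint M (fun p => ereal_of (dapp p x))); last first.
  by apply/funext => M /=; exact: gintIE.
apply: (@gint_measurable R _ (giry_inhabited (unsquash h)) h); last first.
  by move=> p; exact: ereal_of_ge0.
exact: (@meas_map_measurable_fun _ _ (dapp_map R x)).
Qed.

Definition bary_map : meas_map (giry_space R (dist_space R X)) (dist_space R X) :=
  MeasMap bary_measurable.

End countable_set.

Definition U_bary (X : kleisli_countable R) :
    meas_map (giry_space R (dist_space R (sval X))) (dist_space R (sval X)) :=
  bary_map (svalP X).

Lemma U_bary_natural (X Y : kleisli_countable R) (f : hom X Y) :
  meas_comp (U_dist_map f) (U_bary X) =
  meas_comp (U_bary Y) (giry_hom R (U_dist_map f)).
Proof.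
apply: meas_map_ext => M /=; apply: dist_ext_mean => w; apply: ereal_of_inj.
rewrite mean_dmult mean_dmap !mean_bary.
(* The change of variables asks for a nonempty target; a probability measure lives on a nonempty
   space, and the image of a point of it serves. *)
pose hY := squash (U_dist_map f (unsquash (giry_inhabited M))).
rewrite (@gint_gmap _ _ _ _ (hY)).
- by congr gint; apply/funext => p /=; rewrite mean_dmult mean_dmap.
- exact: (mean_measurable w (svalP Y)).
- by move=> p; exact: ereal_of_ge0.
Qed.

Definition giry_counit :
    nat_trans (functor_comp (giry_functor R) (U_dist R)) (U_dist R) :=
  @NatTrans _ _ (functor_comp (giry_functor R) (U_dist R)) (U_dist R)
    U_bary U_bary_natural.

(** The equation that determines the codensity unit. *)
Lemma bary_unit (X : Type) (cX : countable [set: X]) (p : dist_space R X) :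
  bary cX (gdirac R p) = p.
Proof.
apply: dist_ext => x; rewrite [LHS]gintIE (@gint_dirac _ _ (squash p))//.
exact: (@meas_map_measurable_fun _ (squash p) (dapp_map R x)).
Qed.

(** The equation that determines the codensity multiplication: at [x] both sides are the iterated
    integral of [p x] over [p], then over the measures drawn from [M]. *)
Lemma bary_join (X : Type) (cX : countable [set: X])
    (M : giry_space R (giry_space R (dist_space R X))) :
  bary cX (gjoin M) = bary cX (gmap (bary_map cX) M).
Proof.
apply: dist_ext => x; rewrite [LHS]gintIE [RHS]gintIE.
have [P] := giry_inhabited M; have [p] := giry_inhabited P.
rewrite (@gint_gjoin _ _ (squash p)); first last.
- by move=> ?; exact: ereal_of_ge0.
- exact: (@meas_map_measurable_fun _ (squash p) (dapp_map R x)).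
rewrite (@gint_gmap _ _ _ _ (squash p)); first last.
- by move=> ?; exact: ereal_of_ge0.
- exact: (@meas_map_measurable_fun _ (squash p) (dapp_map R x)).
by congr gint; apply/funext => Q; symmetry; exact: gintIE.
Qed.

End barycenter.

(** * The functional induced by a natural transformation *)

Section factorization.
Variables (R : realType) (H : functor Meas Meas).
Variable s : nat_trans (functor_comp H (U_dist R)) (U_dist R).
Local Notation I := (unit_interval R).

Definition nat_obj : kleisli_countable R :=
  exist (fun X : Type => countable [set: X]) nat (countableP [set: nat]).

(** For any lift [u] of [s] to the Giry functor, naturality forces this to be the barycenter of
    [u Z t] pushed forward along [g]. *)
Definition extend_dist (Z : meas_space) (X : kleisli_countable R)
    (g : meas_map Z (dist_space R (sval X))) : meas_map (H Z) (dist_space R (sval X)) :=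
  meas_comp (s X) (fmap H (g : hom (c := Meas) Z (U_dist R X))).

(** The number $E_t f$. Distributions on [nat] carried by 0 and 1 replace those on a two-element
    set, since [nat] also codes sequences of functions. *)
Definition extend_fun (Z : meas_space) (f : meas_map Z I) : meas_map (H Z) I :=
  meas_comp (dapp_map R 1%N) (extend_dist (X := nat_obj) (meas_comp (bern_map R) f)).

(* Naturality of [s] along the Kleisli map [x |-> bern (w x)]. *)
Lemma extend_fun_mean (Z : meas_space) (X : kleisli_countable R)
    (g : meas_map Z (dist_space R (sval X))) (w : sval X -> I)
    (f : meas_map Z I) (t : mcarrier (H Z)) :
  (forall z, f z = mean (g z : dist R (sval X)) w) ->
  extend_fun f t = mean (extend_dist g t : dist R (sval X)) w.
Proof.
move=> fg; pose k : hom X nat_obj := fun x => bern (w x).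
(* A mixture of the [bern (w x)] is Bernoulli with parameter the mean of [w], so the Bernoulli map
   of [f] factors through [g]. *)
have E : meas_comp (bern_map R) f = meas_comp (U_dist_map k) g.
  apply: meas_map_ext => z /=; symmetry; apply: bern_uniq.
    by rewrite fg dmult_dmapE.
  move=> n; rewrite dmult_dmapE; apply: ereal_of_inj.
  rewrite meanE zeroIE esum1// => x _.
  by rewrite mule0.
rewrite /extend_fun /extend_dist E.
have -> : fmap H (meas_comp (U_dist_map k) g : hom (c := Meas) Z (U_dist R nat_obj)) =
    meas_comp (fmap H (U_dist_map k : hom (c := Meas) (U_dist R X) (U_dist R nat_obj)))
      (fmap H (g : hom (c := Meas) Z (U_dist R X))).
  exact: (@fmapM _ _ H).
have /(congr1 (fun m : meas_map _ _ => m (fmap H (g : hom (c := Meas) Z (U_dist R X)) t))) := naturality s k.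
move=> /= <-.
by rewrite [LHS]dmult_dmapE.
Qed.

End factorization.

(** * Dyadic expansions in the unit interval *)

Section dyadic_expansion.
Variable R : realType.
Local Open Scope ring_scope.

(* The digits are chosen greedily, so that the remainder after [n] digits lies
   in [[0, 2^-n]] even for the expansion 0.111... of 1. *)
Fixpoint dyadic_rem (x : R) (n : nat) : R :=
  if n is m.+1 then
    let r := dyadic_rem x m in
    if 2^-1 ^+ m.+1 <= r then r - 2^-1 ^+ m.+1 else r
  else x.

Definition dyadic_digit (n : nat) : set R :=
  [set x | 2^-1 ^+ n.+1 <= dyadic_rem x n].

Lemma dyadic_remS x n :
  dyadic_rem x n.+1 = dyadic_rem x n - 2^-1 ^+ n.+1 * \1_(dyadic_digit n) x.
Proof.
rewrite indicE /dyadic_digit /=; case: ifPn => xn.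
  by rewrite mem_set// mulr1.
by rewrite memNset ?mulr0 ?subr0//=; exact/negP.
Qed.

Lemma dyadic_rem_bound x n : 0 <= x <= 1 -> 0 <= dyadic_rem x n <= 2^-1 ^+ n.
Proof.
move=> x01; elim: n => [|n /andP[r0 rn]]; first by rewrite expr0.
rewrite [dyadic_rem _ _]/=; case: ifPn; last by rewrite -ltNge r0 => /ltW.
move=> le_r; rewrite subr_ge0 le_r lerBlDr (le_trans rn)//.
by rewrite exprS; lra.
Qed.

Lemma dyadic_partial_sum x n :
  \sum_(0 <= k < n) 2^-1 ^+ k.+1 * \1_(dyadic_digit k) x = x - dyadic_rem x n.
Proof.
elim: n => [|n IH]; first by rewrite big_geq//= subrr.
by rewrite big_nat_recr//= IH -/(dyadic_rem x n.+1) dyadic_remS; lra.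
Qed.

Lemma dyadic_rem_cvg x : 0 <= x <= 1 -> dyadic_rem x @ \oo --> 0.
Proof.
move=> x01; apply: (@squeeze_cvgr _ _ _ _ (cst 0) (geometric 1 2^-1)).
- apply: nearW => n /=; rewrite mul1r; exact: dyadic_rem_bound.
- exact: cvg_cst.
- by apply: cvg_geometric; rewrite ger0_norm; lra.
Qed.

(** The coefficients do not depend on [x]. Composed with a measurable function, this is an exact
    series of scaled indicators, on which countable additivity and homogeneity determine a
    functional. *)
Lemma dyadic_expansion x : 0 <= x <= 1 ->
  (x%:E = \sum_(n <oo) (2^-1 ^+ n.+1)%:E * (\1_(dyadic_digit n) x)%:E)%E.
Proof.
move=> x01; apply/esym/cvg_lim => //.
rewrite (_ : (fun n => _) = fun n => (x - dyadic_rem x n)%:E).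
  apply: cvg_EFin; first by apply: nearW.
  rewrite -[X in _ --> X]subr0; apply: cvgB; first exact: cvg_cst.
  exact: dyadic_rem_cvg.
by apply/funext => n; rewrite -dyadic_partial_sum -sumEFin.
Qed.

(** Each digit is read off from the current remainder, and the next remainder from that digit, so
    the induction runs on remainders alone. *)
Lemma dyadic_measurable n :
  measurable_fun setT (dyadic_rem ^~ n) /\ measurable (dyadic_digit n).
Proof.
have digit k : measurable_fun setT (dyadic_rem ^~ k) -> measurable (dyadic_digit k).
  move=> mr; rewrite -[dyadic_digit k]setTI.
  by apply: measurable_fun_le => //; exact: measurable_cst.
suff mr : measurable_fun setT (dyadic_rem ^~ n) by split => //; exact: digit.
elim: n => [|n IH]; first exact: measurable_id.
under eq_fun do rewrite dyadic_remS.
apply: measurable_funB => //; apply: measurable_funM; first exact: measurable_cst.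
by apply: measurable_indic; exact: digit.
Qed.

End dyadic_expansion.

(** * The functional as an integral, and the resulting lift *)

Section extension_is_integral.
Variables (R : realType) (H : functor Meas Meas).
Variable s : nat_trans (functor_comp H (U_dist R)) (U_dist R).
Local Notation I := (unit_interval R).

Lemma extend_fun_eval (Z : meas_space) (X : kleisli_countable R)
    (g : meas_map Z (dist_space R (sval X))) (x : sval X) (f : meas_map Z I) t :
  (forall z, f z = dapp (g z) x) -> extend_fun s f t = dapp (extend_dist s g t) x.
Proof.
move=> fg; rewrite (@extend_fun_mean _ _ s _ X g (indicI R [set x])).
  by rewrite mean_indicI1.
by move=> z; rewrite mean_indicI1 fg.
Qed.

Lemma extend_fun_one (Z : meas_space) (f : meas_map Z I) t :
  (forall z, ereal_of (f z) = 1) -> ereal_of (extend_fun s f t) = 1.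
Proof.
(* The weight 1 has mean 1 under every distribution, so the choice of map into distributions is
   immaterial. *)
move=> f1; rewrite (@extend_fun_mean _ _ s _ (nat_obj R) (meas_comp (bern_map R) f)
  (indicI R setT)); first exact: mean_indicIT.
by move=> z; apply: ereal_of_inj; rewrite f1 mean_indicIT.
Qed.

Lemma extend_fun_scale (Z : meas_space) (c : I) (f : meas_map Z I) t :
  ereal_of (extend_fun s (mulI_map c f) t) = ereal_of c * ereal_of (extend_fun s f t).
Proof.
(* The weight is [c] at the successful outcome and 0 elsewhere. *)
rewrite (@extend_fun_mean _ _ s _ (nat_obj R) (meas_comp (bern_map R) f)
  (fun n => mulI c (indicI R [set 1%N] n))).
  by rewrite mean_mulI mean_indicI1.
by move=> z; apply: ereal_of_inj; rewrite mean_mulI mean_indicI1 [LHS]mulIE.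
Qed.

Lemma mean_succ (p : dist R nat) :
  ereal_of (mean p (indicI R [set~ 0%N])) = \sum_(n <oo) ereal_of (p n.+1).
Proof.
rewrite mean_nat [LHS]nneseries_recl_shift => [|n]; last first.
  by apply: mule_ge0; exact: ereal_of_ge0.
rewrite indicIE indicE memNset ?mule0 ?add0e; last by move=> /(_ erefl).
apply: eq_eseriesr => n _.
by rewrite indicIE indicE mem_set ?mule1.
Qed.

(** All the [F n] are packed into the single map [tail_map]. Its mass off 0 is [f], and its
    coordinate [n.+1] recovers [F n]. *)
Lemma extend_fun_series (Z : meas_space) (F : nat -> meas_map Z I) (f : meas_map Z I) t :
  (forall z, ereal_of (f z) = \sum_(n <oo) ereal_of (F n z)) ->
  ereal_of (extend_fun s f t) = \sum_(n <oo) ereal_of (extend_fun s (F n) t).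
Proof.
move=> fF; have F1 z : \sum_(n <oo) ereal_of (F n z) <= 1.
  by rewrite -fF ereal_of_le1.
rewrite (@extend_fun_mean _ _ s _ (nat_obj R) (tail_map F1) (indicI R [set~ 0%N])).
  rewrite mean_succ; apply: eq_eseriesr => n _; congr ereal_of; symmetry.
  exact: (@extend_fun_eval _ (nat_obj R) (tail_map F1) n.+1).
by move=> z; apply: ereal_of_inj; rewrite mean_succ fF.
Qed.

Definition ran_prob_fun (Z : meas_space) (t : mcarrier (H Z)) (A : msets Z) : I :=
  extend_fun s (indic_map R A) t.

Lemma ran_prob_is_probability (Z : meas_space) (t : mcarrier (H Z)) :
  is_probability (ran_prob_fun t).
Proof.
split => [A AT|F A tF AE].
  by apply: extend_fun_one => z; rewrite [LHS]indicIE AT indicT.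
(* Pointwise, additivity of indicators is additivity of the Dirac measure at [z]. *)
apply: extend_fun_series => z; exact: (@gapp_bigcup _ _ (gdirac R z) F A tF AE).
Qed.

Definition ran_prob (Z : meas_space) (t : mcarrier (H Z)) : giry_space R Z :=
  exist _ (ran_prob_fun t) (mem_set (ran_prob_is_probability t)).

(** The set where the dyadic digit of index [n] of [f] is 1. *)
Definition level_mset (Z : meas_space) (f : meas_map Z I) (n : nat) : msets Z :=
  mset_of (mmapP f (@subspace_val_measurable (borel R) _ _ (dyadic_measurable R n).2)).

Lemma gint_indic (Z : meas_space) (P : giry_space R Z) (A : msets Z) :
  gint P (fun z => ereal_of (indic_map R A z)) = ereal_of (gapp P A).
Proof.
pose h := giry_inhabited P; rewrite (gintE h).
under eq_integral do rewrite [ereal_of _]indicIE.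
have mA : measurable (val A : set (ptd h)) := set_mem (valP A).
by rewrite (@integral_indic _ (ptd h)) ?setIT// [LHS](prob_measureE _ mA) gapp_msetE.
Qed.

(** Both sides respect the dyadic series of [f] and its scalars; on indicators they agree by the
    definition of [ran_prob]. *)
Lemma extend_fun_gint (Z : meas_space) (f : meas_map Z I) (t : mcarrier (H Z)) :
  ereal_of (extend_fun s f t) = gint (ran_prob t) (fun z => ereal_of (f z)).
Proof.
pose h := giry_inhabited (ran_prob t).
have c01 n : 0 <= (2^-1 ^+ n.+1 : R)%:E <= 1.
  rewrite !lee_fin exprn_ge0 ?exprn_ile1 ?invr_ge0 ?ler0n//=.
  by rewrite invf_le1// ler1n.
pose c n : I := of_ereal (c01 n).
have cE n : ereal_of (c n) = (2^-1 ^+ n.+1)%:E by exact: of_erealK.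
pose F n := mulI_map (c n) (indic_map R (level_mset f n)).
have fF z : ereal_of (f z) = \sum_(n <oo) ereal_of (F n z).
  have /set_mem f01 := valP (f z).
  rewrite [LHS](dyadic_expansion f01); apply: eq_eseriesr => n _.
  by rewrite [RHS]mulIE cE indicIE.
rewrite (extend_fun_series t fF) (gintE h).
under [RHS]eq_integral do rewrite fF.
rewrite integral_nneseries//; last 2 first.
- by move=> n; exact: (@meas_map_measurable_fun _ _ h (F n)).
- by move=> n z _; exact: ereal_of_ge0.
apply: eq_eseriesr => n _; rewrite extend_fun_scale.
under [RHS]eq_integral do rewrite [ereal_of _]mulIE.
rewrite ge0_integralZl ?ereal_of_ge0//; last 2 first.
- exact: (@meas_map_measurable_fun _ _ h (indic_map R (level_mset f n))).
- by move=> z _; exact: ereal_of_ge0.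
by congr (_ * _); rewrite -(gintE h) [RHS]gint_indic.
Qed.

Lemma ran_prob_measurable (Z : meas_space) B :
  msets (giry_space R Z) B -> msets (H Z) (@ran_prob Z @^-1` B).
Proof.
apply: (@subspace_measurable _ (power (msets Z) I) _ (@ran_prob Z)).
by apply: power_measurable => A C; exact: (@mmapP _ _ (extend_fun s (indic_map R A))).
Qed.

Definition ran_map (Z : meas_space) : meas_map (H Z) (giry_space R Z) :=
  MeasMap (@ran_prob_measurable Z).

Lemma ran_map_natural (Y Z : meas_space) (f : meas_map Y Z) :
  meas_comp (giry_hom R f) (ran_map Y) =
  meas_comp (ran_map Z) (fmap H (f : hom (c := Meas) Y Z)).
Proof.
apply: meas_map_ext => t; apply: giry_ext => B.
congr ereal_of.
suff : extend_fun s (indic_map R (mset_preimage f B)) t =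
    extend_fun s (indic_map R B) (fmap H (f : hom (c := Meas) Y Z) t) by [].
(* The indicator of a preimage is the indicator composed with [f]; functoriality of [H] does the
   rest. *)
have E : meas_comp (bern_map R) (indic_map R (mset_preimage f B)) =
    meas_comp (meas_comp (bern_map R) (indic_map R B)) f.
  apply: meas_map_ext => z /=; congr bern; apply: ereal_of_inj.
  by rewrite !indicIE.
rewrite /extend_fun /extend_dist E.
rewrite (_ : fmap H _ = meas_comp (fmap H (meas_comp (bern_map R) (indic_map R B) :
  hom (c := Meas) Z (U_dist R (nat_obj R)))) (fmap H (f : hom (c := Meas) Y Z)))//.
exact: (@fmapM _ _ H).
Qed.

Definition giry_lift : nat_trans H (giry_functor R) :=
  @NatTrans _ _ H (giry_functor R) ran_map ran_map_natural.

(** The barycenter at [x] integrates the evaluation at [x], hence is $E_t$ of it; [extend_fun_eval]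
    with [g] the identity turns this into [s X]. *)
Lemma giry_liftK (X : kleisli_countable R) :
  meas_comp (U_bary X) (ran_map (U_dist R X)) = s X.
Proof.
apply: meas_map_ext => t; apply: dist_ext => x.
rewrite [LHS]gintIE -extend_fun_gint.
rewrite (@extend_fun_eval _ X (meas_id (U_dist R X)) x)//.
rewrite /extend_dist (_ : fmap H _ = meas_id _)//.
exact: (@fmap1 _ _ H).
Qed.

Lemma giry_lift_uniq (u : nat_trans H (giry_functor R)) :
  (forall X, meas_comp (U_bary X) (u (U_dist R X)) = s X) ->
  forall Z, u Z = ran_map Z.
Proof.
move=> us Z; apply: meas_map_ext => t; apply: giry_ext => A.
pose k : meas_map Z (U_dist R (nat_obj R)) := meas_comp (bern_map R) (indic_map R A).
suff : ereal_of (gapp (u Z t) A) = ereal_of (extend_fun s (indic_map R A) t) by [].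
rewrite /extend_fun /extend_dist -(us (nat_obj R)) /=.
(* Naturality of [u] at [k] turns its value at the image of [t] into the pushforward of [u Z t]
   along [k]. *)
have /(congr1 (fun m : meas_map _ _ => m t)) /= <- :=
  naturality u (k : hom (c := Meas) Z (U_dist R (nat_obj R))).
rewrite gintIE.
have [z] := giry_inhabited (u Z t).
rewrite (@gint_gmap _ _ _ _ (squash (k z))); first by rewrite -[LHS]gint_indic.
- exact: (@meas_map_measurable_fun _ _ _ (dapp_map R 1%N)).
- by move=> p; exact: ereal_of_ge0.
Qed.

End extension_is_integral.

(** * The Kan extension and its monad structure *)

Section giry_codensity.
Variable R : realType.

Definition giry_right_kan : right_kan (U_dist R) (U_dist R) :=
  @RightKan _ _ _ (U_dist R) (U_dist R) (giry_functor R) (giry_counit R)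
    (@giry_lift R) (@giry_liftK R) (@giry_lift_uniq R).

(** By uniqueness of lifts, it suffices to compare after the counit. *)
Lemma giry_unitE X : giry_unit R X = codensity_unit giry_right_kan X.
Proof.
apply: (@ran_lift_uniq _ _ _ _ _ giry_right_kan _ _ (giry_unit R)) => Y.
by apply: meas_map_ext => p; exact: bary_unit.
Qed.

Lemma giry_multE X : giry_mult R X = codensity_mult giry_right_kan X.
Proof.
apply: (@ran_lift_uniq _ _ _ _ _ giry_right_kan _ _ (giry_mult R)) => Y.
by apply: meas_map_ext => M; exact: bary_join.
Qed.

End giry_codensity.

(** * Monads sharing an underlying functor *)

Section same_functor.
Variables (C : category) (F : functor C C).

Definition nat_trans_id : nat_trans F F :=
  @NatTrans C C F F (fun X => idm (F X))
    (fun X Y f => etrans (compm1 _) (esym (comp1m _))).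

(** The structures are known to agree only componentwise, so the identity transformation is used in
    place of an equality of records. *)
Lemma monad_isomorphic_same_functor
    (e e' : nat_trans (functor_id C) F)
    (m m' : nat_trans (functor_comp F F) F) mA mF mU mA' mF' mU' :
  (forall X, e X = e' X) -> (forall X, m X = m' X) ->
  monad_isomorphic (@Monad C F e m mA mF mU) (@Monad C F e' m' mA' mF' mU').
Proof.
move=> ee' mm'; exists nat_trans_id, nat_trans_id.
split; try by move=> X; rewrite /= comp1m.
- by split=> X /=; rewrite ?fmap1 ?comp1m ?compm1 ?ee' ?mm'.
- by split=> X /=; rewrite ?fmap1 ?comp1m ?compm1 ?ee' ?mm'.
Qed.

End same_functor.

Theorem theoremA6 (R : realType) :
  is_codensity_monad (U_dist R) (giry_monad R).
Proof.
(* The functor of this Kan extension is [giry_functor R] itself, so both monads share it. *)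
exists (giry_right_kan R).
by apply: monad_isomorphic_same_functor => X; [exact: giry_unitE|exact: giry_multE].
Qed.
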